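(* Let $\mathbb X$ be a pointed regular category. The following conditions are equivalent: (i) the class of split epimorphisms in $\mathbb X$ is a torsion theory class; (ii) $\mathbb X$ is normal; (iii) the class of regular epimorphisms in $\mathbb X$ is a torsion theory class.
   Context: A regular category has finite limits. A pointed regular category is normal if every regular epimorphism in it is a normal epimorphism, i.e. a cokernel (in the usual sense, relative to zero morphisms) of some morphism. Let $\mathcal E$ be a class of epimorphisms in a pointed category $\mathbb X$ containing all isomorphisms and all morphisms to a zero object, viewed as a full subcategory of the category of morphisms of $\mathbb X$ (morphisms are commutative squares). Let $\mathcal T$ be its full subcategory of morphisms to a zero object and $\mathcal F$ its full subcategory of isomorphisms of $\mathbb X$. $\mathcal E$ is a torsion theory class if $(\mathcal E,\mathcal T,\mathcal F)$ is a torsion theory. A pretorsion theory is a triple $(\mathbb C,\mathcal T,\mathcal F)$ with $\mathbb C$ a category and $\mathcal T,\mathcal F$ full replete (closed under isomorphism) subcategories such that, putting $\mathcal Z=\mathcal T\cap\mathcal F$ and calling a morphism null if it factors through an object of $\mathcal Z$: (T1) every morphism from an object of $\mathcal T$ to an object of $\mathcal F$ is null; (T2) for every object $X$ there is a short exact sequence $T\xrightarrow{\ell}X\xrightarrow{r}F$ with $T\in\mathcal T$, $F\in\mathcal F$, i.e. $\ell$ is a kernel of $r$ and $r$ a cokernel of $\ell$, relative to null morphisms (a kernel of $f$ is a $k$ with $fk$ null such that every $u$ with $fu$ null factors uniquely through $k$; cokernels are dual). A torsion theory is a pretorsion theory with $\mathbb C$ pointed and $\mathcal T\cap\mathcal F$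 the full subcategory of zero objects of $\mathbb C$. *)

(* Defs.v *)
From Stdlib Require Import List ProofIrrelevance.

Set Implicit Arguments.
Unset Strict Implicit.

Declare Scope cat_scope.
Delimit Scope cat_scope with cat.

Record Category := {
  Ob :> Type;
  Hom : Ob -> Ob -> Type;
  idm : forall A, Hom A A;
  comp : forall A B C, Hom B C -> Hom A B -> Hom A C;
  comp_id_l : forall A B (f : Hom A B), comp (idm B) f = f;
  comp_id_r : forall A B (f : Hom A B), comp f (idm A) = f;
  comp_assoc : forall A B C D (h : Hom C D) (g : Hom B C) (f : Hom A B),
    comp h (comp g f) = comp (comp h g) f
}.
Arguments Hom {c} A B.
Arguments idm {c} A.
Arguments comp {c A B C} g f.

Notation "g '\c' f" := (comp g f) (at level 40, left associativity) : cat_scope.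
Open Scope cat_scope.

Section Morphisms.
Variable C : Category.

Definition is_iso (A B : C) (f : Hom A B) : Prop :=
  exists g : Hom B A, g \c f = idm A /\ f \c g = idm B.

Definition is_epi (A B : C) (f : Hom A B) : Prop :=
  forall (D : C) (u v : Hom B D), u \c f = v \c f -> u = v.

Definition is_split_epi (A B : C) (f : Hom A B) : Prop :=
  exists s : Hom B A, f \c s = idm B.

Definition is_coequalizer (A B Q : C) (u v : Hom A B) (q : Hom B Q) : Prop :=
  q \c u = q \c v /\
  forall (D : C) (w : Hom B D), w \c u = w \c v ->
    exists! t : Hom Q D, t \c q = w.

Definition is_regular_epi (A B : C) (f : Hom A B) : Prop :=
  exists (D : C) (u v : Hom D A), is_coequalizer u v f.

Definition is_pullback (P A B D : C) (p : Hom P A) (q : Hom P B)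
    (f : Hom A D) (g : Hom B D) : Prop :=
  f \c p = g \c q /\
  forall (E : C) (u : Hom E A) (v : Hom E B), f \c u = g \c v ->
    exists! t : Hom E P, p \c t = u /\ q \c t = v.

Definition is_zero_object (Z : C) : Prop :=
  forall A : C, (exists! f : Hom Z A, True) /\ (exists! f : Hom A Z, True).

Definition pointed : Prop := exists Z : C, is_zero_object Z.

(* A morphism is null relative to a class Z of objects; for
   Z := is_zero_object, null morphisms are the zero morphisms and the kernels
   and cokernels below are the usual ones. *)
Definition is_null (Z : C -> Prop) (A B : C) (f : Hom A B) : Prop :=
  exists O : C, Z O /\ exists (g : Hom A O) (h : Hom O B), f = h \c g.

Definition is_kernel (Z : C -> Prop) (K A B : C) (k : Hom K A) (f : Hom A B)
    : Prop :=
  is_null Z (f \c k) /\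
  forall (D : C) (u : Hom D A), is_null Z (f \c u) ->
    exists! t : Hom D K, k \c t = u.

Definition is_cokernel (Z : C -> Prop) (A B Q : C) (q : Hom B Q) (f : Hom A B)
    : Prop :=
  is_null Z (q \c f) /\
  forall (D : C) (u : Hom B D), is_null Z (u \c f) ->
    exists! t : Hom Q D, t \c q = u.

Definition is_normal_epi (A B : C) (f : Hom A B) : Prop :=
  exists (K : C) (k : Hom K A), is_cokernel is_zero_object f k.

Definition short_exact (Z : C -> Prop) (A B D : C) (l : Hom A B) (r : Hom B D)
    : Prop :=
  is_kernel Z l r /\ is_cokernel Z r l.

End Morphisms.

Record Functor (J C : Category) := {
  fob :> J -> C;
  fmap : forall i j : J, Hom i j -> Hom (fob i) (fob j);
  fmap_id : forall i : J, fmap (idm i) = idm (fob i);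
  fmap_comp : forall (i j k : J) (g : Hom j k) (f : Hom i j),
    fmap (g \c f) = fmap g \c fmap f
}.

Record Cone (J C : Category) (F : Functor J C) := {
  apex : C;
  leg : forall j : J, Hom apex (F j);
  leg_natural : forall (i j : J) (f : Hom i j), fmap F f \c leg i = leg j
}.

Definition is_limit (J C : Category) (F : Functor J C) (L : Cone F) : Prop :=
  forall K : Cone F,
    exists! t : Hom (apex K) (apex L), forall j : J, leg L j \c t = leg K j.

Definition finite_type (T : Type) : Prop :=
  exists s : list T, forall x : T, In x s.

Definition finite_category (J : Category) : Prop :=
  finite_type J /\ forall i j : J, finite_type (Hom i j).

Definition has_finite_limits (C : Category) : Prop :=
  forall J : Category, finite_category J ->
  forall F : Functor J C, exists L : Cone F, is_limit L.

Definition regular_category (C : Category) : Prop :=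
  has_finite_limits C /\
  (forall (A B R : C) (f : Hom A B) (p q : Hom R A),
     is_pullback p q f f ->
     exists (Q : C) (c : Hom A Q), is_coequalizer p q c) /\
  (forall (P A B D : C) (p : Hom P A) (q : Hom P B) (f : Hom A D) (g : Hom B D),
     is_pullback p q f g -> is_regular_epi f -> is_regular_epi q).

Definition normal_category (C : Category) : Prop :=
  pointed C /\ regular_category C /\
  forall (A B : C) (f : Hom A B), is_regular_epi f -> is_normal_epi f.

(* Full subcategories are given by predicates on objects. *)

Definition full_subcategory (C : Category) (P : C -> Prop) : Category := {|
  Ob := {A : C | P A};
  Hom A B := Hom (proj1_sig A) (proj1_sig B);
  idm A := idm (proj1_sig A);
  comp A B D g f := g \c f;
  comp_id_l A B f := comp_id_l f;
  comp_id_r A B f := comp_id_r f;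
  comp_assoc A B D E h g f := comp_assoc h g f
|}.

Definition replete (C : Category) (P : C -> Prop) : Prop :=
  forall (A B : C) (f : Hom A B), is_iso f -> P A -> P B.

Definition pretorsion_theory (C : Category) (T F : C -> Prop) : Prop :=
  let Z := fun A : C => T A /\ F A in
  replete T /\ replete F /\
  (forall (A B : C) (f : Hom A B), T A -> F B -> is_null Z f) /\
  (forall A : C, exists (t f : C) (l : Hom t A) (r : Hom A f),
     T t /\ F f /\ short_exact Z l r).

Definition torsion_theory (C : Category) (T F : C -> Prop) : Prop :=
  pretorsion_theory T F /\ pointed C /\
  forall A : C, (T A /\ F A) <-> is_zero_object A.

Record arrow (X : Category) := Arrow {
  src : X;
  tgt : X;
  mor : Hom src tgt
}.

Record square (X : Category) (f g : arrow X) := Square {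
  top : Hom (src f) (src g);
  bot : Hom (tgt f) (tgt g);
  square_comm : bot \c mor f = mor g \c top
}.

Lemma square_eq (X : Category) (f g : arrow X) (s t : square f g) :
  top s = top t -> bot s = bot t -> s = t.
Proof.
destruct s as [a b e], t as [a' b' e']; simpl; intros -> ->.
now rewrite (proof_irrelevance _ e e').
Qed.

Definition square_id (X : Category) (f : arrow X) : square f f.
Proof.
exists (idm (src f)) (idm (tgt f)).
now rewrite comp_id_l, comp_id_r.
Defined.

Definition square_comp (X : Category) (f g h : arrow X)
  (t : square g h) (s : square f g) : square f h.
Proof.
exists (top t \c top s) (bot t \c bot s).
now rewrite <- comp_assoc, square_comm, comp_assoc, square_comm, comp_assoc.
Defined.

Definition arrow_category (X : Category) : Category.
Proof.
refine {| Ob := arrow X; Hom := @square X;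
          idm := @square_id X; comp := @square_comp X |}.
- intros; apply square_eq; apply comp_id_l.
- intros; apply square_eq; apply comp_id_r.
- intros; apply square_eq; apply comp_assoc.
Defined.

Definition morphism_class (X : Category) := arrow_category X -> Prop.

Definition split_epis (X : Category) : morphism_class X :=
  fun f => is_split_epi (mor f).

Definition regular_epis (X : Category) : morphism_class X :=
  fun f => is_regular_epi (mor f).

Arguments split_epis X : clear implicits.
Arguments regular_epis X : clear implicits.

Definition torsion_theory_class (X : Category) (E : morphism_class X) : Prop :=
  (forall f : arrow X, E f -> is_epi (mor f)) /\
  (forall f : arrow X, is_iso (mor f) -> E f) /\
  (forall f : arrow X, is_zero_object (tgt f) -> E f) /\
  @torsion_theory (full_subcategory E)
    (fun f => is_zero_object (tgt (proj1_sig f)))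
    (fun f => is_iso (mor (proj1_sig f))).

(* Main.v *)
Require Import Defs.
From Stdlib Require Import List.

Set Implicit Arguments.
Unset Strict Implicit.

(** The heart of the matter is a criterion for any class [E] of epimorphisms
    which contains the isomorphisms and the morphisms to zero objects, in a
    pointed category with kernels: [E] is a torsion theory class if and only
    if every member of [E] is a normal epimorphism
    ([torsion_theory_class_iff_normal]).

    When a member [f : A -> B] of [E] is a cokernel of its kernel [k], the
    sequence

      (K -> 0)  --(k, 0)-->  (A -> B)  --(f, 1)-->  (B = B)

    is exact in [E] ([normal_exact_sequence]), because a square is null
    exactly when its two components are zero morphisms.  Conversely, suppose
    that [E] is a torsion theory class.  The squares from [f] to the objects
    [D -> 0], which belong to [E], are just the morphisms [A -> D] of the base
    category.  Testing the cokernel in the exact sequence of [f] against these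
    squares shows that [f] itself is a cokernel
    ([torsion_theory_class_normal]).

    By the criterion, regular epimorphisms form a torsion theory class exactly
    when the category is normal, and then split epimorphisms, being regular,
    form one too.  It remains to see that regular epimorphisms are normal once
    split ones are ([regular_epi_is_normal_of_split]).  The projections [p, q]
    of the kernel pair of a regular epimorphism [f] are split by the diagonal,
    so [p] is a cokernel of some [k], and [f] is then a cokernel of [q \c k]:
    whenever [u \c q \c k] is zero, [u \c q] factors through [p], the diagonal
    shows that the factor is [u], and so [u] coequalizes the kernel pair. *)

(** * Null morphisms and zero objects *)

Notation null f := (is_null (@is_zero_object _) f).

Lemma null_comp_l (C : Category) (Z : C -> Prop) (A B D : C) (g : Hom B D)
  (f : Hom A B) : is_null Z f -> is_null Z (g \c f).
Proof.
intros (O & hO & a & b & ->). exists O; split; [exact hO|].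
exists a, (g \c b). apply comp_assoc.
Qed.

Lemma null_comp_r (C : Category) (Z : C -> Prop) (A B D : C) (g : Hom B D)
  (f : Hom A B) : is_null Z g -> is_null Z (g \c f).
Proof.
intros (O & hO & a & b & ->). exists O; split; [exact hO|].
exists (a \c f), b. symmetry; apply comp_assoc.
Qed.

Lemma zero_from_unique (C : Category) (Z A : C) (f g : Hom Z A) :
  is_zero_object Z -> f = g.
Proof.
intros hZ. destruct (hZ A) as [(t & _ & ht) _].
now rewrite <- (ht f I), <- (ht g I).
Qed.

Lemma zero_to_unique (C : Category) (Z A : C) (f g : Hom A Z) :
  is_zero_object Z -> f = g.
Proof.
intros hZ. destruct (hZ A) as [_ (t & _ & ht)].
now rewrite <- (ht f I), <- (ht g I).
Qed.

(** The two morphisms may factor through different zero objects; these are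
    compared by the morphism between them. *)
Lemma null_unique (C : Category) (A B : C) (f g : Hom A B) :
  null f -> null g -> f = g.
Proof.
intros (O & hO & a & b & ->) (O' & hO' & a' & b' & ->).
destruct (hO O') as [(m & _) _].
rewrite (zero_from_unique b (b' \c m) hO), <- comp_assoc.
f_equal. now apply zero_to_unique.
Qed.

Lemma null_of_zero_src (C : Category) (A B : C) (f : Hom A B) :
  is_zero_object A -> null f.
Proof.
intros hA. exists A; split; [exact hA|]. exists (idm A), f.
symmetry; apply comp_id_r.
Qed.

Lemma is_iso_idm (C : Category) (A : C) : is_iso (idm A).
Proof. exists (idm A); split; apply comp_id_l. Qed.

Lemma is_iso_sym (C : Category) (A B : C) (f : Hom A B) (g : Hom B A) :
  g \c f = idm A -> f \c g = idm B -> is_iso g.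
Proof. intros h h'; now exists f. Qed.

Lemma zero_object_replete (C : Category) : replete (@is_zero_object C).
Proof.
intros A B f (g & hgf & hfg) hA D.
destruct (hA D) as [(a & _) (b & _)]. split.
- exists (a \c g); split; [exact I|]. intros x _.
  rewrite (zero_from_unique a (x \c f) hA), <- comp_assoc, hfg.
  apply comp_id_r.
- exists (f \c b); split; [exact I|]. intros x _.
  rewrite (zero_to_unique b (g \c x) hA), comp_assoc, hfg.
  apply comp_id_l.
Qed.

Lemma zero_objects_iso (C : Category) (Z Z' : C) :
  is_zero_object Z -> is_zero_object Z' -> exists f : Hom Z Z', is_iso f.
Proof.
intros hZ hZ'.
destruct (hZ Z') as [(f & _) (g & _)].
exists f, g; split; [now apply zero_from_unique|now apply zero_to_unique].
Qed.

(** * Epimorphisms *)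

Lemma regular_epi_is_epi (C : Category) (A B : C) (f : Hom A B) :
  is_regular_epi f -> is_epi f.
Proof.
intros (D & a & b & hab & hu) E u v huv.
destruct (hu E (u \c f)) as (t & _ & ht).
- rewrite <- !comp_assoc. now f_equal.
- now rewrite <- (ht u eq_refl), <- (ht v (eq_sym huv)).
Qed.

(** A retraction [f] of [s] is the coequalizer of the identity and the
    idempotent [s \c f]. *)
Lemma split_epi_is_regular (C : Category) (A B : C) (f : Hom A B) :
  is_split_epi f -> is_regular_epi f.
Proof.
intros (s & hs). exists A, (idm A), (s \c f). split.
- now rewrite comp_id_r, comp_assoc, hs, comp_id_l.
- intros D w hw. rewrite comp_id_r, comp_assoc in hw.
  exists (w \c s); split; [easy|].
  intros t <-. now rewrite <- comp_assoc, hs, comp_id_r.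
Qed.

Lemma iso_is_split_epi (C : Category) (A B : C) (f : Hom A B) :
  is_iso f -> is_split_epi f.
Proof. intros (g & _ & h); now exists g. Qed.

Lemma to_zero_is_split_epi (C : Category) (A B : C) (f : Hom A B) :
  is_zero_object B -> is_split_epi f.
Proof.
intros hB. destruct (hB A) as [(s & _) _].
exists s. now apply zero_from_unique.
Qed.

(** * Pullbacks and kernels from finite limits *)

Inductive cospan_ob : Type := CospanL | CospanR | CospanM.

Definition cospan_le (i j : cospan_ob) : bool :=
  match i, j with
  | CospanL, CospanL | CospanR, CospanR | _, CospanM => true
  | _, _ => false
  end.

(** Between any two objects there is at most one morphism, so the laws of a
    category hold trivially. *)
Definition cospan_hom (i j : cospan_ob) : Type :=
  if cospan_le i j then unit else Empty_set.

Lemma cospan_hom_unique (i j : cospan_ob) (a b : cospan_hom i j) : a = b.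
Proof. destruct i, j; destruct a, b; reflexivity. Qed.

Definition cospan_id (i : cospan_ob) : cospan_hom i i :=
  match i with CospanL | CospanR | CospanM => tt end.

Definition cospan_comp (i j k : cospan_ob) (b : cospan_hom j k)
  (a : cospan_hom i j) : cospan_hom i k.
Proof.
destruct i, j, k; first [exact tt | destruct a; fail | destruct b; fail].
Defined.

Definition cospan : Category.
Proof.
refine {| Ob := cospan_ob; Hom := cospan_hom; idm := cospan_id;
          comp := cospan_comp |}; intros; apply cospan_hom_unique.
Defined.

Lemma cospan_finite : finite_category cospan.
Proof.
split.
- exists (CospanL :: CospanR :: CospanM :: nil).
  intros []; simpl; tauto.
- intros i j; destruct i, j;
    first [now exists nil; intros [] | exists (tt :: nil); intros []; now left].
Qed.

Definition cospan_functor (C : Category) (A B D : C) (f : Hom A D)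
  (g : Hom B D) : Functor cospan C.
Proof.
unshelve refine {| fob := fun i : cospan =>
  match i with CospanL => A | CospanR => B | CospanM => D end |}.
- intros [] [] a; first [destruct a; fail | exact (idm _) | exact f | exact g].
- now intros [].
- intros [] [] [] b a; first [now destruct a | now destruct b |
    symmetry; apply comp_id_l | symmetry; apply comp_id_r].
Defined.

Definition cospan_cone (C : Category) (A B D : C) (f : Hom A D) (g : Hom B D)
  (P : C) (p : Hom P A) (q : Hom P B) (e : f \c p = g \c q) :
  Cone (cospan_functor f g).
Proof.
exists P (fun j : cospan =>
  match j return Hom P (cospan_functor f g j) with
  | CospanL => p | CospanR => q | CospanM => f \c p end).
intros [] [] a; first [destruct a; fail | apply comp_id_l | reflexivity |
  symmetry; exact e].
Defined.

Lemma pullback_exists (C : Category) (A B D : C) (f : Hom A D) (g : Hom B D) :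
  has_finite_limits C ->
  exists (P : C) (p : Hom P A) (q : Hom P B), is_pullback p q f g.
Proof.
intros hC.
destruct (hC cospan cospan_finite (cospan_functor f g)) as (L & hL).
pose proof (leg_natural L (tt : @Hom cospan CospanL CospanM)) as hf.
pose proof (leg_natural L (tt : @Hom cospan CospanR CospanM)) as hg.
simpl in hf, hg.
exists (apex L), (leg L CospanL), (leg L CospanR); split.
- simpl. exact (eq_trans hf (eq_sym hg)).
- intros E u v e.
  destruct (hL (cospan_cone e)) as (t & ht & hu).
  exists t; split.
  + split; [exact (ht CospanL)|exact (ht CospanR)].
  + intros t' [h1 h2]. apply hu. intros []; [exact h1|exact h2|].
    simpl. rewrite <- h1, comp_assoc. simpl in *. now rewrite hf.
Qed.

Lemma kernel_exists (C : Category) (A B : C) (f : Hom A B) :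
  pointed C -> has_finite_limits C ->
  exists (K : C) (k : Hom K A), is_kernel (@is_zero_object C) k f.
Proof.
intros (Z & hZ) hC. destruct (hZ B) as [(z & _) _].
destruct (pullback_exists f z hC) as (K & k & w & e & hP).
exists K, k; split.
- rewrite e. exists Z; split; [exact hZ|]. now exists w, z.
- intros D u hu. destruct (hZ D) as [_ (v & _)].
  destruct (hP D u v) as (t & [ht _] & ht').
  + apply null_unique; [exact hu|]. apply null_comp_r.
    now apply null_of_zero_src.
  + exists t; split; [exact ht|]. intros t' h'. apply ht'.
    split; [exact h'|now apply zero_to_unique].
Qed.

(** * Classes of epimorphisms as categories *)

Notation to_zero E :=
  (fun f : full_subcategory E => is_zero_object (tgt (proj1_sig f))).
Notation isos E := (fun f : full_subcategory E => is_iso (mor (proj1_sig f))).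
Notation zero_isos E := (fun f => to_zero E f /\ isos E f).

Definition member (X : Category) (E : morphism_class X) (A B : X)
  (f : Hom A B) (hf : E (Arrow f)) : full_subcategory E := exist _ _ hf.

(** Morphisms of the full subcategory are squares only up to conversion; this
    cast gives access to their components. *)
Definition hom_square (X : Category) (E : morphism_class X)
  (f g : full_subcategory E) (s : Hom f g) :
  square (proj1_sig f) (proj1_sig g) := s.

Lemma null_square (X : Category) (E : morphism_class X) :
  pointed X -> (forall f : arrow X, is_iso (mor f) -> E f) ->
  forall (f g : full_subcategory E) (s : Hom f g),
  is_null (zero_isos E) s <->
  null (top (hom_square s)) /\ null (bot (hom_square s)).
Proof.
intros hX hiso f g s; split.
- intros (O & [hO hi] & a & b & ->). split.
  + destruct hi as (i & hi).
    exists (src (proj1_sig O)); split.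
    * destruct hi as [h1 h2]. exact (zero_object_replete (is_iso_sym h1 h2) hO).
    * now exists (top (hom_square a)), (top (hom_square b)).
  + exists (tgt (proj1_sig O)); split; [exact hO|].
    now exists (bot (hom_square a)), (bot (hom_square b)).
- intros [ht hb]. destruct hX as (Z & hZ).
  set (O := member (hiso (Arrow (idm Z)) (is_iso_idm Z))).
  destruct (hZ (src (proj1_sig f))) as [_ (a & _)].
  destruct (hZ (tgt (proj1_sig f))) as [_ (b & _)].
  destruct (hZ (src (proj1_sig g))) as [(c & _) _].
  destruct (hZ (tgt (proj1_sig g))) as [(d & _) _].
  assert (e1 : b \c mor (proj1_sig f) = idm Z \c a)
    by now apply zero_to_unique.
  assert (e2 : d \c idm Z = mor (proj1_sig g) \c c)
    by now apply zero_from_unique.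
  exists O; split; [split; [exact hZ|apply is_iso_idm]|].
  exists (Square (g := proj1_sig O) e1 : @Hom (full_subcategory E) f O),
    (Square (f := proj1_sig O) e2 : @Hom (full_subcategory E) O g).
  apply square_eq; simpl; apply null_unique; try assumption;
    now apply null_comp_r, null_of_zero_src.
Qed.

Lemma to_zero_replete (X : Category) (E : morphism_class X) :
  replete (to_zero E).
Proof.
intros f g s (t & h1 & h2) hf.
apply (zero_object_replete (f := bot (hom_square s))); [|exact hf].
exists (bot (hom_square t)); split.
- exact (f_equal (fun x => bot (hom_square x)) h1).
- exact (f_equal (fun x => bot (hom_square x)) h2).
Qed.

(** An inverse of the given isomorphism is conjugated by the two components
    of the invertible square. *)
Lemma isos_replete (X : Category) (E : morphism_class X) : replete (isos E).
Proof.
intros f g s (t & h1 & h2) (i & hi1 & hi2).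
pose proof (f_equal (fun x => top (hom_square x)) h1) as ht1.
pose proof (f_equal (fun x => top (hom_square x)) h2) as ht2.
pose proof (f_equal (fun x => bot (hom_square x)) h2) as hb2.
pose proof (square_comm (hom_square s)) as cs.
pose proof (square_comm (hom_square t)) as ct.
simpl in ht1, ht2, hb2.
exists (top (hom_square s) \c i \c bot (hom_square t)); split.
- rewrite <- comp_assoc, ct, <- comp_assoc.
  rewrite (comp_assoc i), hi1, comp_id_l. exact ht2.
- rewrite !comp_assoc, <- cs, <- (comp_assoc _ _ i), hi2, comp_id_r.
  exact hb2.
Qed.

Lemma zero_isos_are_zero (X : Category) (E : morphism_class X)
  (f : full_subcategory E) : zero_isos E f -> is_zero_object f.
Proof.
intros [hf (i & hi1 & hi2)].
assert (hs : is_zero_object (src (proj1_sig f)))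
  by exact (zero_object_replete (is_iso_sym hi1 hi2) hf).
intros g.
destruct (hs (src (proj1_sig g))) as [(a & _) (b & _)].
destruct (hf (tgt (proj1_sig g))) as [(c & _) (d & _)].
split.
- assert (e : c \c mor (proj1_sig f) = mor (proj1_sig g) \c a)
    by now apply zero_from_unique.
  exists (Square e : @Hom (full_subcategory E) f g); split; [exact I|].
  intros s _; apply square_eq; now apply zero_from_unique.
- assert (e : d \c mor (proj1_sig g) = mor (proj1_sig f) \c b)
    by now apply zero_to_unique.
  exists (Square e : @Hom (full_subcategory E) g f); split; [exact I|].
  intros s _; apply square_eq; now apply zero_to_unique.
Qed.

Lemma exists_zero_iso (X : Category) (E : morphism_class X) :
  pointed X -> (forall f : arrow X, is_iso (mor f) -> E f) ->
  exists f : full_subcategory E, zero_isos E f.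
Proof.
intros (Z & hZ) hiso.
exists (member (hiso (Arrow (idm Z)) (is_iso_idm Z))).
split; [exact hZ|apply is_iso_idm].
Qed.

Lemma zero_isos_iff (X : Category) (E : morphism_class X) :
  pointed X -> (forall f : arrow X, is_iso (mor f) -> E f) ->
  forall f : full_subcategory E, zero_isos E f <-> is_zero_object f.
Proof.
intros hX hiso f; split; [apply zero_isos_are_zero|]. intros hf.
destruct (exists_zero_iso hX hiso) as (O & hO1 & hO2).
destruct (zero_objects_iso (zero_isos_are_zero (conj hO1 hO2)) hf)
  as (s & hs).
split; [exact (to_zero_replete hs hO1)|exact (isos_replete hs hO2)].
Qed.

(** A square from [A -> 0] to an isomorphism [g] has zero bottom; its top is
    then zero because [g] can be cancelled. *)
Lemma to_zero_isos_null (X : Category) (E : morphism_class X) :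
  pointed X -> (forall f : arrow X, is_iso (mor f) -> E f) ->
  forall (f g : full_subcategory E) (s : Hom f g),
  to_zero E f -> isos E g -> is_null (zero_isos E) s.
Proof.
intros hX hiso f g s hf (i & hi & _).
apply (null_square hX hiso).
assert (hb : null (bot (hom_square s))) by now apply null_of_zero_src.
split; [|exact hb].
rewrite <- (comp_id_l (top (hom_square s))), <- hi, <- comp_assoc.
apply null_comp_l. rewrite <- square_comm. now apply null_comp_r.
Qed.

(** * Torsion theory classes and normal epimorphisms *)

(** The sequence is [(K -> 0) -> f -> (B = B)].  Its exactness at the top is
    the hypothesis on [k] and [f]; the bottom components are zero on the
    kernel side, and on the cokernel side they commute with the factorization
    through [f] because [f] is an epimorphism. *)
Lemma normal_exact_sequence (X : Category) (E : morphism_class X) :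
  pointed X -> (forall f : arrow X, is_iso (mor f) -> E f) ->
  (forall f : arrow X, is_zero_object (tgt f) -> E f) ->
  forall (f : full_subcategory E) (K : X) (k : Hom K (src (proj1_sig f))),
  is_epi (mor (proj1_sig f)) ->
  is_kernel (@is_zero_object X) k (mor (proj1_sig f)) ->
  is_cokernel (@is_zero_object X) (mor (proj1_sig f)) k ->
  exists (t g : full_subcategory E) (l : Hom t f) (r : Hom f g),
    to_zero E t /\ isos E g /\ short_exact (zero_isos E) l r.
Proof.
intros hX hiso hzero [[A B f] Ef] K k; simpl; intros hepi hker hcok.
pose proof hX as (Z & hZ).
destruct (hZ K) as [_ (z & _)], (hZ B) as [(w & _) _].
assert (el : w \c z = f \c k).
{ apply null_unique; [|exact (proj1 hker)].
  now apply null_comp_r, null_of_zero_src. }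
assert (er : idm B \c f = idm B \c f) by reflexivity.
set (a := member Ef).
set (t := member (hzero (Arrow z) hZ)).
set (g := member (hiso (Arrow (idm B)) (is_iso_idm B))).
set (l := Square (f := Arrow z) (g := Arrow f) el
      : @Hom (full_subcategory E) t a).
set (r := Square (f := Arrow f) (g := Arrow (idm B)) er
      : @Hom (full_subcategory E) a g).
exists t, g, l, r.
split; [exact hZ|]. split; [apply is_iso_idm|]. split; split.
- apply (to_zero_isos_null hX hiso); [exact hZ|apply is_iso_idm].
- intros [[D D' d] Ed] [u v e] hu.
  apply (null_square hX hiso) in hu; simpl in hu, u, v, e.
  destruct hu as [hu hv]. rewrite comp_id_l in hv.
  destruct (proj2 hker D u hu) as (x & hx & ux).
  destruct (hZ D') as [_ (y & _)].
  assert (exy : y \c d = z \c x) by now apply zero_to_unique.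
  exists (Square (f := Arrow d) (g := Arrow z) exy); split.
  + apply square_eq; simpl; [exact hx|].
    apply null_unique; [|exact hv]. now apply null_comp_r, null_of_zero_src.
  + intros [x' y' e'] h. simpl in x', y', e'.
    apply square_eq; simpl; [|now apply zero_to_unique].
    apply ux. exact (f_equal (fun s => top (hom_square s)) h).
- apply (to_zero_isos_null hX hiso); [exact hZ|apply is_iso_idm].
- intros [[D D' d] Ed] [u v e] hu.
  apply (null_square hX hiso) in hu; simpl in hu, u, v, e.
  destruct hu as [hu _].
  destruct (proj2 hcok D u hu) as (x & hx & ux).
  assert (exv : v \c idm B = d \c x).
  { apply hepi. now rewrite comp_id_r, <- comp_assoc, hx. }
  exists (Square (f := Arrow (idm B)) (g := Arrow d) exv); split.
  + apply square_eq; simpl; [exact hx|apply comp_id_r].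
  + intros [x' y' e'] h. simpl in x', y', e'.
    apply square_eq; simpl.
    * apply ux. exact (f_equal (fun s => top (hom_square s)) h).
    * transitivity (y' \c idm B); [|apply comp_id_r].
      symmetry. exact (f_equal (fun s => bot (hom_square s)) h).
Qed.

(** Let [(r0, r1)] be a cokernel of [(l0, l1)], with codomain an isomorphism
    [g], and with [(l0, l1)] coming from an object over zero.  A morphism [u]
    with [u \c l0] zero is a square from [f] to an object over zero; this
    square factors through [(r0, r1)], so [u = x \c r0] for some [x].  As
    [r0 = g^-1 \c r1 \c f], this is a factorization of [u] through [f], and
    so [f] is a cokernel of [l0]. *)
Lemma torsion_theory_class_normal (X : Category) (E : morphism_class X) :
  pointed X -> torsion_theory_class E ->
  forall f : arrow X, E f -> is_normal_epi (mor f).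
Proof.
intros hX (hepi & hiso & hzero & (_ & _ & _ & hseq) & _) [A B f] Ef.
destruct (hseq (member Ef)) as
  ([[T T' t] Et] & [[F F' g] Eg] & [l0 l1 el] & [r0 r1 er] & ht & hg & _ & hc).
simpl in *. destruct hg as (i & hig & _).
assert (efl : f \c l0 = l1 \c t) by now symmetry.
exists T, l0; split.
- rewrite efl. now apply null_comp_r, null_of_zero_src.
- intros D u hu. pose proof hX as (Z & hZ).
  destruct (hZ D) as [_ (d & _)], (hZ B) as [_ (b & _)].
  assert (eu : b \c f = d \c u) by now apply zero_to_unique.
  destruct (proj2 hc (member (hzero (Arrow d) hZ))
    (Square (f := Arrow f) (g := Arrow d) eu)) as ([x y e] & hx & _).
  + apply (null_square hX hiso); simpl. split; [exact hu|].
    now apply null_comp_l, null_of_zero_src.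
  + apply (f_equal (fun s => top (hom_square s))) in hx. simpl in hx, x.
    exists (x \c i \c r1); split.
    * rewrite <- comp_assoc, er, <- comp_assoc, (comp_assoc i), hig.
      now rewrite comp_id_l.
    * intros v hv. apply (hepi (Arrow f) Ef); simpl.
      rewrite hv, <- hx, <- (comp_assoc _ r1), er, <- (comp_assoc x).
      now rewrite (comp_assoc i), hig, comp_id_l.
Qed.

(** Whatever [f] is a cokernel of factors through [k], so a morphism which
    kills [k] kills it too. *)
Lemma normal_epi_cokernel_of_kernel (C : Category) (A B K : C) (f : Hom A B)
  (k : Hom K A) :
  is_normal_epi f -> is_kernel (@is_zero_object C) k f ->
  is_cokernel (@is_zero_object C) f k.
Proof.
intros (K' & k' & hn & hu) (hk & hker). split; [exact hk|].
intros D u huk. apply hu.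
destruct (hker K' k' hn) as (t & <- & _).
rewrite comp_assoc. now apply null_comp_r.
Qed.

Theorem torsion_theory_class_iff_normal (X : Category)
  (E : morphism_class X) :
  pointed X -> has_finite_limits X ->
  (forall f : arrow X, E f -> is_epi (mor f)) ->
  (forall f : arrow X, is_iso (mor f) -> E f) ->
  (forall f : arrow X, is_zero_object (tgt f) -> E f) ->
  torsion_theory_class E <-> (forall f : arrow X, E f -> is_normal_epi (mor f)).
Proof.
intros hX hlim hepi hiso hzero.
split; [now apply torsion_theory_class_normal|]. intros hnormal.
split; [exact hepi|]. split; [exact hiso|]. split; [exact hzero|].
split; [|split].
- split; [apply to_zero_replete|]. split; [apply isos_replete|]. split.
  + intros f g s; now apply to_zero_isos_null.
  + intros f.
    destruct (kernel_exists (mor (proj1_sig f)) hX hlim) as (K & k & hk).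
    apply (normal_exact_sequence hX hiso hzero (k := k)).
    * apply hepi, (proj2_sig f).
    * exact hk.
    * apply normal_epi_cokernel_of_kernel; [|exact hk].
      apply hnormal, (proj2_sig f).
- destruct (exists_zero_iso hX hiso) as (O & hO).
  exists O. now apply zero_isos_are_zero.
- now apply zero_isos_iff.
Qed.

(** * Normality is decided by split epimorphisms *)

Lemma regular_epi_coequalizes_kernel_pair (C : Category) (A B R : C)
  (f : Hom A B) (p q : Hom R A) :
  is_regular_epi f -> is_pullback p q f f -> is_coequalizer p q f.
Proof.
intros (D & a & b & hab & hu) [hpq hP]. split; [exact hpq|].
intros E w hw. apply hu.
destruct (hP D a b hab) as (t & [<- <-] & _).
now rewrite !comp_assoc, hw.
Qed.

(** The projections of a kernel pair are split by the diagonal, so normality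
    of [p] can be carried over to [f] along [q]. *)
Lemma regular_epi_is_normal_of_split (C : Category) :
  has_finite_limits C ->
  (forall (A B : C) (f : Hom A B), is_split_epi f -> is_normal_epi f) ->
  forall (A B : C) (f : Hom A B), is_regular_epi f -> is_normal_epi f.
Proof.
intros hlim hsplit A B f hf.
destruct (pullback_exists f f hlim) as (R & p & q & hR).
destruct (regular_epi_coequalizes_kernel_pair hf hR) as [hpq hcoeq].
destruct (proj2 hR A (idm A) (idm A) eq_refl) as (s & [hps hqs] & _).
destruct (hsplit R A p (ex_intro _ s hps)) as (K & k & hpk & hp).
exists K, (q \c k); split.
- rewrite comp_assoc, <- hpq, <- comp_assoc. now apply null_comp_l.
- intros D u hu. apply hcoeq.
  rewrite comp_assoc in hu.
  destruct (hp D (u \c q) hu) as (t & ht & _).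
  (* Composing [t \c p = u \c q] with the diagonal [s]. *)
  assert (htu : t = u).
  { now rewrite <- (comp_id_r t), <- hps, comp_assoc, ht, <- comp_assoc, hqs,
      comp_id_r. }
  now rewrite <- ht, htu.
Qed.

Theorem theorem4p4 (X : Category) (hpointed : pointed X)
  (hregular : regular_category X) :
  (torsion_theory_class (split_epis X) <-> normal_category X) /\
  (normal_category X <-> torsion_theory_class (regular_epis X)).
Proof.
pose proof (proj1 hregular) as hlim.
assert (hs : torsion_theory_class (split_epis X) <->
  forall f : arrow X, split_epis X f -> is_normal_epi (mor f)).
{ apply torsion_theory_class_iff_normal; try assumption; intros f hf.
  - now apply regular_epi_is_epi, split_epi_is_regular.
  - now apply iso_is_split_epi.
  - now apply to_zero_is_split_epi. }
assert (hr : torsion_theory_class (regular_epis X) <->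
  forall f : arrow X, regular_epis X f -> is_normal_epi (mor f)).
{ apply torsion_theory_class_iff_normal; try assumption; intros f hf.
  - now apply regular_epi_is_epi.
  - now apply split_epi_is_regular, iso_is_split_epi.
  - now apply split_epi_is_regular, to_zero_is_split_epi. }
rewrite hs, hr. split; split.
- intros h. split; [exact hpointed|]. split; [exact hregular|].
  apply (regular_epi_is_normal_of_split hlim).
  intros A B f. exact (h (Arrow f)).
- intros (_ & _ & h) f hf. now apply h, split_epi_is_regular.
- intros (_ & _ & h) f. apply h.
- intros h. split; [exact hpointed|]. split; [exact hregular|].
  intros A B f. exact (h (Arrow f)).
Qed.
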